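(* $\mathfrak{hom}_{\mathcal{B}}=\max\{\mathfrak{d},\mathfrak{r}_{\mathcal{B}}\}$ for every non-trivial barrier $\mathcal{B}$ on $\omega$.
   Context: For sets of naturals, $s\sqsubseteq t$ means $s$ is an initial segment of $t$. For $\mathcal{F}\subseteq[\omega]^{<\omega}$ and $M\subseteq\omega$ let $\mathcal{F}|M=\{s\in\mathcal{F}:s\subseteq M\}$. A barrier on an infinite set $M\subseteq\omega$ is a family $\mathcal{B}$ of finite subsets of $M$ such that (a) $s\subseteq t$ implies $s=t$ for $s,t\in\mathcal{B}$, and (b) every infinite $N\subseteq M$ has an initial segment $s\sqsubseteq N$ with $s\in\mathcal{B}$. A barrier $\mathcal{B}$ on $\omega$ is non-trivial if $\mathcal{B}\neq[\omega]^1$ (and $\mathcal{B}\neq\{\emptyset\}$). For $n\in M$ put $\mathcal{B}(n)=\{t\in\mathcal{B}:\min t=n\}$ and $\mathcal{B}[n]=\{t\setminus\{n\}:t\in\mathcal{B}(n)\}$, which is a barrier on $M\setminus(n+1)$ when $\mathcal{B}\neq\{\emptyset\}$. $\mathsf{FIN}^{\mathcal{B}}$ is the ideal on $\mathcal{B}$ defined recursively: $\mathsf{FIN}^{\{\emptyset\}}=\{\emptyset\}$ (only the empty subset of $\{\emptyset\}$), and otherwise $X\subseteq\mathcal{B}$ is in $\mathsf{FIN}^{\mathcal{B}}$ iff the set of $n$ such that $\{s\setminus\{n\}:s\in X\cap\mathcal{B}(n)\}\notin\mathsf{FIN}^{\mathcal{B}[n]}$ is finite. For an ideal $\mathcal{I}$,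 $X\subseteq_{\mathcal{I}}Y$ means $X\setminus Y\in\mathcal{I}$. For $S\subseteq\mathcal{B}$ write $S^0=S$ and $S^1=\mathcal{B}\setminus S$. $\mathfrak{d}$ is the dominating number (least size of a $\leq^*$-dominating family in $\omega^\omega$), and $$\mathfrak{hom}_{\mathcal{B}}=\min\{|\mathcal{H}|:\mathcal{H}\subseteq[\omega]^\omega\ \wedge\ \forall S\subseteq\mathcal{B}\ \exists M\in\mathcal{H}\ \exists i\in2\ (\mathcal{B}|M\subseteq S^i)\},$$ $$\mathfrak{r}_{\mathcal{B}}=\min\{|\mathcal{R}|:\mathcal{R}\subseteq[\omega]^\omega\ \wedge\ \forall S\subseteq\mathcal{B}\ \exists R\in\mathcal{R}\ \exists i\in2\ (\mathcal{B}|R\subseteq_{\mathsf{FIN}^{\mathcal{B}}}S^i)\}.$$ *)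

(* Defs.v *)
From mathcomp Require Import all_boot finmap.
From mathcomp Require Import mathcomp_extra boolp classical_sets functions.
From mathcomp Require Import cardinality filter.

Set Implicit Arguments.
Unset Strict Implicit.
Unset Printing Implicit Defensive.

Local Open Scope fset_scope.
Local Open Scope classical_set_scope.
Local Open Scope card_scope.

(* A cardinal is given by any set having that cardinality and is considered up
   to [#=].  [card_min P] is a member of [P] of least cardinality, which exists
   as soon as [P] is nonempty ([card_minP]). *)
Definition card_min (T : Type) (P : set (set T)) : set T :=
  xget set0 [set A | P A /\ forall B, P B -> A #<= B].

Definition card_max (T U : Type) (A : set T) (B : set U) : set (T + U) :=
  if `[< A #<= B >] then inr @` B else inl @` A.

(* Hönig's argument: a maximal family of pairwise everywhere distinct elements
   of the product of the [A i] is in bijection with one of the factors. *)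
Lemma card_family_least (I T : Type) (A : I -> set T) :
  inhabited I -> exists i, forall j, A i #<= A j.
Proof.
move=> [i0].
pose good (F : set (I -> T)) := (forall f i, F f -> A i (f i)) /\
  (forall f g i, F f -> F g -> f i = g i -> f = g).
have [F [[Fin Finj] Fmax]] : exists F, good F /\ forall G, F `<` G -> ~ good G.
  apply: Zorn_bigcup => C Cgood Ctot; split.
    by move=> f i [X CX Xf]; have [+ _] := Cgood _ CX; apply.
  move=> f g i [X CX Xf] [Y CY Yg].
  have [XY|YX] := Ctot _ _ CX CY.
    by have [_] := Cgood _ CY; apply => //; apply: XY.
  by have [_] := Cgood _ CX; apply => //; apply: YX.
have [i Ai] : exists i, forall x, A i x -> exists2 f, F f & f i = x.
  apply: contrapT => /forallNP noi.
  have /choice[h hP] : forall i, exists x, A i x /\ forall f, F f -> f i <> x.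
    move=> i; apply: contrapT => Hi; apply: (noi i) => x Aix.
    apply: contrapT => Hx; apply: Hi; exists x; split=> // f Ff fx.
    by apply: Hx; exists f.
  apply: (Fmax (F `|` [set h])).
    split; first exact: subsetUl.
    move=> /(_ h) Fh; have {}Fh : F h by apply: Fh; right.
    by have [_ /(_ h Fh)] := hP i0.
  split=> [f i [/Fin//|->]|f g i [Ff|->] [Fg|->] // fg].
  - by have [] := hP i.
  - exact: Finj fg.
  - by have [_ /(_ f Ff)] := hP i.
  - by have [_ /(_ g Fg)] := hP i; rewrite fg.
exists i => j.
have evF k : (fun f : I -> T => f k) @` F #= F.
  by apply: inj_card_eq => f g /set_mem Ff /set_mem Fg; exact: Finj.
have -> : A i = (fun f : I -> T => f i) @` F.
  by apply/seteqP; split=> [x /Ai[f Ff <-]|_ [f /Fin Af <-]]; [exists f|].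
rewrite (card_le_eql (evF i)) -(card_le_eql (evF j)).
by apply: subset_card_le => _ [f /Fin Af <-].
Qed.

Lemma card_minP (T : Type) (P : set (set T)) : P !=set0 ->
  P (card_min P) /\ forall B, P B -> card_min P #<= B.
Proof.
move=> [A0 PA0].
have [[A PA] Amin] := @card_family_least {A : set T | P A} T sval
  (inhabits (exist _ A0 PA0)).
apply: (@xgetPex _ set0 [set A | P A /\ forall B, P B -> A #<= B]).
by exists A; split=> // B PB; exact: Amin (exist _ B PB).
Qed.

Lemma card_le_total (T U : Type) (A : set T) (B : set U) :
  A #<= B \/ B #<= A.
Proof.
have cl : (@inl T U) @` A #= A by apply: inj_card_eq => x y _ _ [].
have cr : (@inr T U) @` B #= B by apply: inj_card_eq => x y _ _ [].
have [[] bmin] := @card_family_least bool _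
  (fun b : bool => if b then inl @` A else inr @` B) (inhabits true).
- by left; rewrite -(card_le_eql cl) -(card_le_eqr cr); exact: bmin false.
- by right; rewrite -(card_le_eqr cl) -(card_le_eql cr); exact: bmin true.
Qed.

Lemma card_maxP (T U V : Type) (A : set T) (B : set U) (C : set V) :
  card_max A B #<= C <-> A #<= C /\ B #<= C.
Proof.
have cl : (@inl T U) @` A #= A by apply: inj_card_eq => x y _ _ [].
have cr : (@inr T U) @` B #= B by apply: inj_card_eq => x y _ _ [].
rewrite /card_max; case: asboolP => AB.
  rewrite (card_le_eql cr); split=> [BC|[]//].
  by split=> //; exact: card_le_trans BC.
rewrite (card_le_eql cl); split=> [AC|[]//].
have [//|BA] := card_le_total A B.
by split=> //; exact: card_le_trans AC.
Qed.

Definition below (F : set {fset nat}) (M : set nat) : set {fset nat} :=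
  [set s | F s /\ [set` s] `<=` M].

Definition init_seg (s : {fset nat}) (N : set nat) : Prop :=
  [set` s] `<=` N /\ forall m n, m \in s -> N n -> (n <= m)%N -> n \in s.

Definition barrier (M : set nat) (B : set {fset nat}) : Prop :=
  [/\ infinite_set M,
      forall s, B s -> [set` s] `<=` M,
      forall s t, B s -> B t -> (s `<=` t)%fset -> s = t &
      forall N, infinite_set N -> N `<=` M -> exists2 s, B s & init_seg s N].

Definition nontrivial (B : set {fset nat}) : Prop :=
  B <> [set s | #|` s| = 1%N] /\ B <> [set fset0].

Definition starting_at (B : set {fset nat}) (n : nat) : set {fset nat} :=
  [set t | B t /\ n \in t /\ forall m, m \in t -> (n <= m)%N].

(* [starting_at B n] is [B(n)], and [strip n (starting_at B n)] is [B[n]]. *)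
Definition strip (n : nat) (X : set {fset nat}) : set {fset nat} :=
  [set (t `\ n)%fset | t in X].

(* The ideal [FIN^B] of a barrier [B] on [M].  Mathematically this is a
   recursion along the (well-founded) rank of [B]; it is rendered as a least
   fixed point, in which finiteness of the set of [n] in [M] whose section is
   not in [FIN^B[n]] is expressed positively, as containment in a finite set
   [E].  The recursive clauses are recovered by [FIN_trivialE] and [FINE]. *)
Inductive FIN (M : set nat) (B X : set {fset nat}) : Prop :=
| FIN_trivial of B = [set fset0] & X = set0
| FIN_rec (E : set nat) of B <> [set fset0] & X `<=` B & finite_set E &
    (forall n, M n -> ~ E n ->
       FIN (M `&` [set m | (n < m)%N]) (strip n (starting_at B n))
           (strip n (X `&` starting_at B n))).

Lemma FIN_trivialE (M : set nat) (X : set {fset nat}) :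
  FIN M [set fset0] X <-> X = set0.
Proof. by split=> [[]//|]; exact: FIN_trivial. Qed.

Lemma FINE (M : set nat) (B X : set {fset nat}) : B <> [set fset0] ->
  FIN M B X <->
  X `<=` B /\
  finite_set [set n | M n /\
    ~ FIN (M `&` [set m | (n < m)%N]) (strip n (starting_at B n))
          (strip n (X `&` starting_at B n))].
Proof.
move=> Bn0; split=> [[//|E _ XB Efin FE]|[XB Efin]].
  split=> //; apply: sub_finite_set Efin => n [Mn nFIN].
  by apply: contrapT => nE; apply: nFIN; exact: FE.
apply: (FIN_rec Bn0 XB Efin) => n Mn /= nE.
by apply: contrapT => nFIN; exact: nE.
Qed.

Definition subset_mod (T : Type) (I : set (set T)) (X Y : set T) : Prop :=
  I (X `\` Y).

Definition side (T : Type) (B S : set T) (i : bool) : set T :=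
  if i then B `\` S else S.

Definition dominating_number : set (nat -> nat) :=
  card_min [set D | forall f : nat -> nat, exists2 g, D g &
    \forall n \near \oo, (f n <= g n)%N].

Definition hom_number (B : set {fset nat}) : set (set nat) :=
  card_min [set H : set (set nat) | (forall M, H M -> infinite_set M) /\
    forall S, S `<=` B -> exists2 M, H M &
      exists i, below B M `<=` side B S i].

(* [B] is meant to be a barrier on ω, hence the base set [setT]. *)
Definition reaping_number (B : set {fset nat}) : set (set nat) :=
  card_min [set R : set (set nat) | (forall M, R M -> infinite_set M) /\
    forall S, S `<=` B -> exists2 M, R M &
      exists i, subset_mod (FIN setT B) (below B M) (side B S i)].

(* Main.v *)
(* [d <= hom_B]: colour [s] in [B] by whether some [b] in [s] satisfies
   [a < b <= f a] for some [a] in [s].  A set homogeneous for this colouring can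
   only be of the sparse colour, and since [B] has only finitely many
   singletons, consecutive elements of it bound [f] almost everywhere.

   [hom_B <= max (d, r_B)]: membership of [X] in [FIN^B] is witnessed by finite
   exceptional sets along the tree of initial segments of [B], and a single
   function [f] bounds them all, so that no element of [X] is contained in a set
   sparse with respect to [f] (up to finitely many elements).  Thinning out each
   member of a reaping family along each member of a dominating family makes it
   homogeneous; the number of sets so obtained is computed by Hessenberg's
   theorem.  Nash-Williams' theorem ensures that the three minima are taken over
   nonempty collections. *)
Require Import Defs.
From mathcomp Require Import all_boot finmap.
From mathcomp Require Import boolp classical_sets cardinality.
From mathcomp Require Import functions filter.

Local Open Scope classical_set_scope.
Local Open Scope card_scope.

Set Implicit Arguments.
Unset Strict Implicit.
Unset Printing Implicit Defensive.

(** * Comparing cardinals by injections; Hessenberg's theorem *)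

Lemma card_le_inj (T U : Type) (A : set T) (B : set U) (f : T -> U) :
  (forall x, A x -> B (f x)) ->
  (forall x y, A x -> A y -> f x = f y -> x = y) -> A #<= B.
Proof.
move=> fAB finj; have /injfunPex[h] : exists2 f, set_fun A B f & set_inj A f.
  by exists f => // x y /set_mem Ax /set_mem Ay; exact: finj.
exact: inj_card_le h.
Qed.

Lemma card_le_injP (T U : Type) (A : set T) (B : set U) : inhabited U ->
  A #<= B -> exists f : T -> U, (forall x, A x -> B (f x)) /\
    (forall x y, A x -> A y -> f x = f y -> x = y).
Proof.
move=> [u]; elim/Ppointed: U => U in u B *; first by case: (no u).
move=> /pcard_leP/injfunPex[f fAB finj]; exists f; split=> // x y Ax Ay.
by apply: finj; exact: mem_set.
Qed.

Section Hessenberg.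
Variables (T : Type) (K : set T).

Let base (G : set (T * T * T)) : set T := [set x | exists z, G (x, x, z)].

(** An injection [A * A -> A] with [A] inside [K], encoded as its graph with [A = base G]: partial
    injections are then ordered by inclusion, and chains have their union as upper bound. *)
Let pairing (G : set (T * T * T)) : Prop :=
  [/\ base G `<=` K,
      forall x y, base G x -> base G y -> exists z, G (x, y, z),
      forall x y z, G (x, y, z) -> [/\ base G x, base G y & base G z],
      forall p z z', G (p, z) -> G (p, z') -> z = z' &
      forall p p' z, G (p, z) -> G (p', z) -> p = p'].

Let baseS G G' : G `<=` G' -> base G `<=` base G'.
Proof. by move=> GG' x [z /GG']; exists z. Qed.

Let graph (A : set T) (F : T * T -> T) : set (T * T * T) :=
  [set w | [/\ A w.1.1, A w.1.2 & w.2 = F w.1]].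

Let base_graph A F : base (graph A F) = A.
Proof.
apply/seteqP; split=> [x [z []]//|x Ax]; by exists (F (x, x)).
Qed.

Let pairing_graph A F : A `<=` K -> (forall x y, A x -> A y -> A (F (x, y))) ->
  (forall x y x' y', A x -> A y -> A x' -> A y' ->
     F (x, y) = F (x', y') -> (x, y) = (x', y')) -> pairing (graph A F).
Proof.
move=> AK FA Finj; rewrite /pairing base_graph; split=> //.
- by move=> x y Ax Ay; exists (F (x, y)).
- by move=> x y z [/= Ax Ay ->]; split=> //; exact: FA.
- by move=> p z z' [_ _ /= ->] [_ _ /= ->].
- move=> [x y] [x' y'] z [/= Ax Ay ->] [/= Ax' Ay']; exact: Finj.
Qed.

(* Hessenberg's theorem: a maximal injection [A * A -> A] with [A] infinite has
   [K `\` A #<= A], as otherwise it extends to [A] together with a disjoint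
   copy of [A]. *)
Lemma infinite_card_square : infinite_set K -> K `*` K #<= K.
Proof.
move=> Kinf; have [x0 Kx0] := infinite_setN0 Kinf.
have /infiniteP/(card_le_injP (inhabits x0))[e [eK einj]] := Kinf.
pose A0 := range e.
have [u uK] : exists u : T -> nat, forall n, u (e n) = n.
  have /choice[u uP] : forall x, exists n, A0 x -> e n = x.
    move=> x; have [[n _ nx]|nx] := pselect (A0 x); last by exists 0 => /nx.
    by exists n.
  by exists u => n; apply: einj => //; rewrite uP//; exists n.
(* The seed is a pairing of a countably infinite subset of [K], transported from [nat] along [e]. *)
pose G0 := graph A0 (fun p => e (choice.pickle (u p.1, u p.2))).
have pG0 : pairing G0.
  apply: pairing_graph; first by move=> _ [n _ <-]; exact: eK.
    by move=> x y _ _; exists (choice.pickle (u x, u y)).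
  move=> _ _ _ _ [i _ <-] [j _ <-] [i' _ <-] [j' _ <-] /= /einj.
  rewrite !uK => /(_ I I)/(congr1 (@choice.unpickle (nat * nat)%type)).
  by rewrite !choice.pickleK => -[-> ->].
(* Zorn's lemma is applied to what is added to [G0]. The empty chain then causes no trouble, and the
   base of the maximal graph contains the infinite set [A0]. In the facts below, [X = set0] accounts
   for triples coming from [G0] itself. *)
have [G [pG Gmax]] :
    exists G, pairing (G0 `|` G) /\ forall G', G `<` G' -> ~ pairing (G0 `|` G').
  apply: Zorn_bigcup => C CP Ctot; set U := \bigcup_(X in C) X.
  have pC w : (G0 `|` U) w -> exists2 X, (X = set0 \/ C X) & (G0 `|` X) w.
    by move=> [G0w|[X CX Xw]]; [exists set0; [left|left]|exists X; [right|right]].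
  have {}CP X : X = set0 \/ C X -> pairing (G0 `|` X).
    by move=> [->|/CP//]; rewrite setU0.
  have CU X : X = set0 \/ C X -> G0 `|` X `<=` G0 `|` U.
    by move=> [->|CX]; [rewrite setU0; exact: subsetUl|apply: setUS => w Xw; exists X].
  have pC2 w w' : (G0 `|` U) w -> (G0 `|` U) w' ->
      exists X, [/\ X = set0 \/ C X, (G0 `|` X) w & (G0 `|` X) w'].
    move=> /pC[X CX Xw] /pC[Y CY Yw'].
    have [XY|YX] : X `<=` Y \/ Y `<=` X.
      by case: CX CY => [->|CX] [->|CY]; [left|left|right|exact: Ctot].
    - by exists Y; split=> //; exact: setUS Xw.
    - by exists X; split=> //; exact: setUS Yw'.
  split.
  - move=> x [z /pC[X CX Xz]]; have [XK _ _ _ _] := CP _ CX.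
    by apply: XK; exists z.
  - move=> x y [z zP] [t tP]; have [X [CX Xz Xt]] := pC2 _ _ zP tP.
    have [_ + _ _ _] := CP _ CX.
    by move=> /(_ x y (ex_intro _ z Xz) (ex_intro _ t Xt))[v /(CU _ CX)]; exists v.
  - move=> x y z /pC[X CX Xw]; have s := baseS (CU _ CX).
    have [_ _ /(_ _ _ _ Xw)[bx bky bz] _ _] := CP _ CX.
    by split; exact: s.
  - move=> p z z' zP zP'; have [X [CX Xz Xz']] := pC2 _ _ zP zP'.
    by have [_ _ _ + _] := CP _ CX; apply; eassumption.
  - move=> p p' z zP zP'; have [X [CX Xz Xz']] := pC2 _ _ zP zP'.
    by have [_ _ _ _] := CP _ CX; apply; eassumption.
set H := G0 `|` G in pG; pose A := base H.
have [AK Hex HA Hfun Hinj] := pG.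
have A0A : A0 `<=` A.
  by rewrite -(base_graph A0 _ : base G0 = A0); apply: baseS => w; left.
have /choice[f fP] : forall p, exists z, A p.1 -> A p.2 -> H (p, z).
  move=> [x y] /=.
  have [[Ax Ay]|nA] := pselect (A x /\ A y); last by exists x0 => Ax Ay; case: nA.
  by have [z Hz] := Hex _ _ Ax Ay; exists z.
have fA x y : A x -> A y -> A (f (x, y)).
  by move=> Ax Ay; have /HA[] := fP (x, y) Ax Ay.
have finj x y x' y' : A x -> A y -> A x' -> A y' ->
    f (x, y) = f (x', y') -> (x, y) = (x', y').
  move=> Ax Ay Ax' Ay' ff; apply: Hinj (fP (x, y) Ax Ay) _.
  by rewrite ff; exact: fP.
have eA n : A (e n) by apply: A0A; exists n.
have en n m : e n = e m -> n = m by exact: einj.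
(* If [K \ A] injects into [A], then so does all of [K]: the tags [e 0] and [e 1] keep the two
   pieces apart. Composing with [f] sends [K * K] into [A]. *)
have [KA|AKA] := card_le_total (K `\` A) A.
  have [g [gA ginj]] := card_le_injP (inhabits x0) KA.
  pose h x := if `[< A x >] then f (e 0, x) else f (e 1, g x).
  have hA x : K x -> A (h x).
    by rewrite /h; case: asboolP => Ax Kx; apply: fA => //; exact: gA.
  have hinj x y : K x -> K y -> h x = h y -> x = y.
    rewrite /h; case: asboolP => Ax; case: asboolP => Ay Kx Ky.
    - by move=> /(finj _ _ _ _ (eA _) Ax (eA _) Ay)[].
    - by move=> /(finj _ _ _ _ (eA _) Ax (eA _) (gA _ (conj Ky Ay)))[/en].
    - by move=> /(finj _ _ _ _ (eA _) (gA _ (conj Kx Ax)) (eA _) Ay)[/en].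
    - move=> /(finj _ _ _ _ (eA _) (gA _ (conj Kx Ax)) (eA _) (gA _ (conj Ky Ay)))[].
      exact: ginj.
  apply: (@card_le_inj _ _ _ _ (fun p => f (h p.1, h p.2))).
    by move=> [x y] [/= Kx Ky]; apply: AK; apply: fA; exact: hA.
  move=> [x y] [x' y'] [/= Kx Ky] [/= Kx' Ky'].
  move=> /(finj _ _ _ _ (hA _ Kx) (hA _ Ky) (hA _ Kx') (hA _ Ky'))[].
  by move=> /hinj-> // /hinj->.
have [g [gK ginj]] := card_le_injP (inhabits x0) AKA.
have gA x : A x -> ~ A (g x) by move=> /gK[].
pose A' := A `|` g @` A.
(* [v] folds [A'] onto [A]: it is the identity on [A] and inverts [g] on the copy. *)
have /choice[v vP] : forall x, exists y, A' x -> A y /\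
    (A x /\ y = x \/ ~ A x /\ g y = x).
  move=> x; have [Ax|nAx] := pselect (A x); first by exists x => _; split=> //; left.
  have [[y Ay yx]|ng] := pselect ((g @` A) x).
    by exists y => _; split=> //; right.
  by exists x0; case.
have vA x : A' x -> A (v x) by move=> /vP[].
have vinj x y : A' x -> A' y -> `[< A x >] = `[< A y >] -> v x = v y -> x = y.
  move=> /vP[_ vx] /vP[_ vy] Axy vxy.
  have {}Axy : A x <-> A y.
    by split=> /asboolP; [rewrite Axy|rewrite -Axy] => /asboolP.
  case: vx => -[Ax vx]; case: vy => -[Ay vy]; first by rewrite -vx vxy.
  - by case: Ay; apply/Axy.
  - by case: Ax; apply/Axy.
  - by rewrite -vx vxy.
pose tag (p : T * T) := (`[< A p.1 >] + (`[< A p.2 >]).*2)%N.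
pose F p := if tag p == 3 then f p else g (f (e (tag p), f (v p.1, v p.2))).
have tag3 x y : tag (x, y) = 3 -> A x /\ A y.
  by rewrite /tag /=; case: asboolP => //; case: asboolP.
have ffA t x y : A' x -> A' y -> A (f (e t, f (v x, v y))).
  by move=> A'x A'y; apply: (fA) => //; apply: fA; exact: vA.
have AF x y : A x -> A y -> F (x, y) = f (x, y).
  by move=> Ax Ay; rewrite /F /tag /= !asboolT.
have A'K : A' `<=` K.
  by move=> x [/AK//|[y /gK[Kx _] <-]].
have FA' x y : A' x -> A' y -> A' (F (x, y)).
  rewrite /F; case: eqP => [/tag3[Ax Ay] _ _|_ A'x A'y]; first by left; exact: fA.
  by right; eexists; [|reflexivity]; exact: ffA.
case: (Gmax (graph A' F)).
  have HG : H `<=` graph A' F.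
    move=> [[x y] z] Hw; have [Ax Ay _] := HA _ _ _ Hw; split; [by left|by left|].
    by rewrite AF//; apply: Hfun Hw _; exact: fP.
  split; first by move=> w Gw; apply: HG; right.
  move=> /(_ (g (e 0), g (e 0), F (g (e 0), g (e 0)))) GG.
  have /HA[/(gA _ (eA 0))//] : H (g (e 0), g (e 0), F (g (e 0), g (e 0))).
  by right; apply: GG; split=> //; right; exists (e 0).
have -> : G0 `|` graph A' F = graph A' F.
  apply/setUidPr => -[[x y] z] /(@or_introl _ (G (x, y, z))) Hw.
  have [Ax Ay _] := HA _ _ _ Hw; split; [by left|by left|].
  by rewrite AF//; apply: Hfun Hw _; exact: fP.
apply: pairing_graph => // x y x' y' A'x A'y A'x' A'y'.
rewrite /F; case: eqP => [/tag3[Ax Ay]|t]; case: eqP => [/tag3[Ax' Ay']|t'].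
- exact: finj.
- by move=> fg; case: (gA _ (ffA (tag (x', y')) _ _ A'x' A'y')); rewrite -fg; exact: fA.
- by move=> fg; case: (gA _ (ffA (tag (x, y)) _ _ A'x A'y)); rewrite fg; exact: fA.
have vv : A (f (v x, v y)) by apply: fA; exact: vA.
have vv' : A (f (v x', v y')) by apply: fA; exact: vA.
move=> /(ginj _ _ (fA _ _ (eA _) vv) (fA _ _ (eA _) vv')).
move=> /(finj _ _ _ _ (eA _) vv (eA _) vv')[/en tt].
move=> /(finj _ _ _ _ (vA _ A'x) (vA _ A'y) (vA _ A'x') (vA _ A'y'))[vx vy].
have [ax ay] : `[< A x >] = `[< A x' >] /\ `[< A y >] = `[< A y' >].
  by move: tt; rewrite /tag /=; do 4 case: `[< _ >].
by rewrite (vinj x x')// (vinj y y').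
Qed.

End Hessenberg.

(** * Infinite sets of naturals and their sparse subsets *)

Lemma infinite_unbounded (M : set nat) (k : nat) :
  infinite_set M -> exists2 m, M m & (k <= m)%N.
Proof.
move=> Minf; have [m [Mm km]] : (M `\` `I_k) !=set0.
  by apply: infinite_setN0; apply: infinite_setD => //; exact: finite_II.
by exists m => //; rewrite leqNgt; apply/negP.
Qed.

Lemma unbounded_infinite (M : set nat) :
  (forall k, exists2 m, M m & (k <= m)%N) -> infinite_set M.
Proof.
move=> Munb /finite_fsetP[X MX].
have [m Mm] := Munb (\max_(x <- X) x).+1.
apply/negP; rewrite -leqNgt; move: Mm; rewrite MX /= => mX.
by rewrite (big_fsetD1 m)//= leq_maxl.
Qed.

Lemma infinite_tail (M : set nat) (n : nat) :
  infinite_set M -> infinite_set (M `&` [set m | (n < m)%N]).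
Proof.
move=> Minf; apply: unbounded_infinite => k.
have [m Mm] := infinite_unbounded (maxn k n.+1) Minf.
by rewrite geq_max => /andP[km nm]; exists m.
Qed.

Lemma increasing_ltn (x : nat -> nat) : (forall k, x k < x k.+1)%N ->
  forall i j, (i < j)%N -> (x i < x j)%N.
Proof.
move=> xS i j; apply: (@homo_ltn _ x (fun a b => a < b)%N) => //.
exact: ltn_trans.
Qed.

Lemma increasing_ge (x : nat -> nat) : (forall k, x k < x k.+1)%N ->
  forall k, (k <= x k)%N.
Proof. by move=> xS; elim=> // k /leq_ltn_trans; apply. Qed.

Lemma fset_min (s : {fset nat}) : s != fset0 ->
  exists2 a, a \in s & forall m, m \in s -> (a <= m)%N.
Proof.
by move=> /fset0Pn s0; case: (ex_minnP s0) => a sa amin; exists a.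
Qed.

Definition monotone_majorant (f : nat -> nat) (n : nat) : nat :=
  \max_(i < n.+1) f i.

Lemma monotone_majorant_ge f a n : (a <= n)%N -> (f a <= monotone_majorant f n)%N.
Proof.
rewrite -ltnS => an.
exact: (@leq_bigmax _ (fun i : 'I_n.+1 => f i) (Ordinal an)).
Qed.

Definition sparse (f : nat -> nat) (M : set nat) : Prop :=
  forall a b, M a -> M b -> (a < b)%N -> (f a < b)%N.

Lemma sparse_subset (f : nat -> nat) (k : nat) (N : set nat) : infinite_set N ->
  exists M, [/\ infinite_set M, M `<=` N, sparse f M &
    forall a, M a -> (k <= a)%N].
Proof.
move=> Ninf.
have /choice[h hP] : forall m, exists n, N n /\ (m <= n)%N.
  by move=> m; have [n] := infinite_unbounded m Ninf; exists n.
(* Each point passes both its predecessor and the bound there; since the sequence increases,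
   sparseness at consecutive points gives it for all pairs. *)
pose next a := h (maxn a (monotone_majorant f a)).+1.
pose x i := iter i next (h k).
have xS i : (maxn (x i) (monotone_majorant f (x i)) < x i.+1)%N.
  by have [_] := hP (maxn (x i) (monotone_majorant f (x i))).+1.
have xlt i : (x i < x i.+1)%N by apply: leq_ltn_trans (xS i); exact: leq_maxl.
exists (range x); split.
- apply: unbounded_infinite => i; exists (x i); first by exists i.
  exact: increasing_ge.
- by move=> _ [[|i] _ <-]; [exact: (hP k).1|exact: (hP _).1].
- move=> _ _ [i _ <-] [j _ <-] xij.
  have ij : (i < j)%N.
    rewrite ltnNge; apply/negP; rewrite leq_eqVlt => /orP[/eqP ji|ji].
      by rewrite ji ltnn in xij.
    by have := ltn_trans xij (increasing_ltn xlt ji); rewrite ltnn.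
  apply: (@leq_ltn_trans (monotone_majorant f (x i))).
    exact: monotone_majorant_ge.
  apply: (@leq_trans (x i.+1)).
    by apply: leq_ltn_trans (xS i); exact: leq_maxr.
  move: ij; rewrite leq_eqVlt => /orP[/eqP->//|ij].
  exact/ltnW/increasing_ltn.
- move=> _ [i _ <-]; apply: (@leq_trans (x 0)); first by have [] := hP k.
  by case: i => // i; apply/ltnW/increasing_ltn.
Qed.

(** * Sections of a barrier and induction on barriers *)

Section BarrierInduction.
Implicit Types (M N : set nat) (B : set {fset nat}).

Lemma barrier_fset0 M B : barrier M B -> B fset0 -> B = [set fset0].
Proof.
move=> [_ _ Banti _] B0; apply/seteqP; split=> [s Bs|_ ->//].
by rewrite /= -(Banti _ _ B0 Bs)// fsub0set.
Qed.

Lemma starting_at_min B s : B s -> s != fset0 ->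
  exists2 n, n \in s & starting_at B n s.
Proof. by move=> Bs /fset_min[n sn nmin]; exists n. Qed.

Lemma fsetD1_inj (n : nat) (s t : {fset nat}) : n \in s -> n \in t ->
  (s `\ n)%fset = (t `\ n)%fset -> s = t.
Proof. by move=> /fsetD1K{2}<- /fsetD1K{2}<- ->. Qed.

Lemma strip_tail M B n t : (forall s, B s -> [set` s] `<=` M) ->
  strip n (starting_at B n) t -> [set` t] `<=` M `&` [set m | (n < m)%N].
Proof.
move=> BM [s [Bs [sn nmin]] <-] m /=; rewrite !inE => /andP[mn sm].
by split; [exact: BM sm|rewrite ltn_neqAle eq_sym mn nmin].
Qed.

(** For the covering property, [n] is put back in front of [N]. The initial segment that [B]
    provides is nonempty, hence contains the minimum [n], and removing [n] leaves an initial segment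
    of [N]. *)
Lemma barrier_strip M B n : barrier M B -> B <> [set fset0] -> M n ->
  barrier (M `&` [set m | (n < m)%N]) (strip n (starting_at B n)).
Proof.
move=> hB Bn0 Mn; have [Minf BM Banti Bbar] := hB; split.
- exact: infinite_tail.
- by move=> t; exact: strip_tail.
- move=> _ _ [s [Bs [sn _]] <-] [t [Bt [tn _]] <-] st.
  congr (_ `\ _)%fset; apply: Banti => //.
  by rewrite -(fsetD1K sn) -(fsetD1K tn) fsetUS.
- move=> N Ninf NM.
  have [||s Bs [sN sinit]] := Bbar (n |` N).
  + by apply: sub_infinite_set Ninf; exact: subsetUr.
  + by move=> m [->//|/NM[]].
  have n_min m : (n |` N) m -> (n <= m)%N by move=> [->//|/NM[_ /ltnW]].
  have [|a sa _] := @fset_min s.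
    by apply/eqP => s0; apply: Bn0; apply: barrier_fset0 hB _; rewrite -s0.
  have sn : n \in s by apply: (sinit a) => //; [by left|exact: n_min (sN _ _)].
  exists (s `\ n)%fset.
    by exists s => //; split=> //; split=> // m /sN/n_min.
  split=> [m /=|m k]; rewrite !inE.
    by move=> /andP[mn /sN[/eqP|//]]; rewrite (negbTE mn).
  move=> /andP[mn sm] Nk km; apply/andP; split; last by apply: sinit km => //; right.
  by have [_ /=] := NM _ Nk; rewrite ltn_neqAle eq_sym => /andP[].
Qed.

(** This replaces induction on the rank. A counterexample has a section that is again a
    counterexample; iterating gives points [n 0 < n 1 < ...], and the member of [B] that is an
    initial segment of this sequence would end the descent after finitely many steps. *)
Lemma barrier_induction (P : set nat -> set {fset nat} -> Prop) :
  (forall M, infinite_set M -> P M [set fset0]) ->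
  (forall M B, barrier M B -> B <> [set fset0] ->
     (forall n, M n -> P (M `&` [set m | (n < m)%N]) (strip n (starting_at B n))) ->
     P M B) ->
  forall M B, barrier M B -> P M B.
Proof.
move=> P0 PS M B hB; apply: contrapT => nP.
pose bad (x : set nat * set {fset nat}) := barrier x.1 x.2 /\ ~ P x.1 x.2.
pose next (x : set nat * set {fset nat}) n :=
  (x.1 `&` [set m | (n < m)%N], strip n (starting_at x.2 n)).
have bad_ne0 x : bad x -> x.2 <> [set fset0].
  by case: x => M' B' [/= [Minf _ _ _] nP'] B0; apply: nP'; rewrite B0; exact: P0.
have /choice[h hP] : forall x, exists n, bad x -> x.1 n /\ bad (next x n).
  move=> x; have [bx|nbx] := pselect (bad x); last by exists 0 => /nbx.
  have [hx nPx] := bx; have xn0 := bad_ne0 _ bx.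
  apply: contrapT => /forallNP nn; apply: nPx; apply: PS => // n xn.
  apply: contrapT => nPn; apply: (nn n) => _; split=> //; split=> //.
  exact: barrier_strip.
pose x k := iter k (fun y => next y (h y)) (M, B).
have badx k : bad (x k) by elim: k => [//|k /hP[]].
pose n k := h (x k).
have xn k : (x k).1 (n k) by have [] := hP _ (badx k).
have xS k : (x k.+1).1 `<=` (x k).1 `&` [set m | (n k < m)%N] by [].
have xle i j : (i <= j)%N -> (x j).1 `<=` (x i).1.
  move=> /subnK<-; elim: (j - i)%N => [//|d IH].
  by rewrite addSn => m /xS[/IH].
have nlt k : (n k < n k.+1)%N by have /xS[] := xn k.+1.
pose N k := n @` [set j | (k <= j)%N].
have Ninf k : infinite_set (N k).
  apply: unbounded_infinite => m; exists (n (maxn k m)).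
    by exists (maxn k m) => //=; exact: leq_maxl.
  by apply: leq_trans (increasing_ge nlt _); exact: leq_maxr.
(* By induction on the size of [s]: removing the minimum [n k] passes to the next section. Once the
   empty set is reached, the section is the trivial barrier, which is never bad. *)
have noseg j : forall (s : {fset nat}) k,
    (#|` s| <= j)%N -> (x k).2 s -> init_seg s (N k) -> False.
  elim: j => [|j IH] s k sj xs [sN sinit].
    move: sj; rewrite leqn0 cardfs_eq0 => /eqP s0; rewrite s0 in xs.
    by apply: (bad_ne0 _ (badx k)); apply: (barrier_fset0 (badx k).1).
  have s0 : s != fset0.
    apply/eqP => s0; rewrite s0 in xs.
    by apply: (bad_ne0 _ (badx k)); apply: (barrier_fset0 (badx k).1).
  have nmin m : N k m -> (n k <= m)%N.
    move=> [i /= + <-]; rewrite leq_eqVlt => /orP[/eqP->//|ki].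
    exact/ltnW/increasing_ltn.
  have [a sa _] := fset_min s0.
  have sn : n k \in s.
    by apply: (sinit a) => //; [by exists k => /=|exact: nmin (sN _ _)].
  have NS m : N k m -> m != n k -> N k.+1 m.
    move=> [i /= + <-]; rewrite leq_eqVlt => /orP[/eqP->|ki _]; first by rewrite eqxx.
    by exists i.
  apply: (IH (s `\ n k)%fset k.+1).
  - by move: sj; rewrite (cardfsD1 (n k)) sn.
  - by exists s => //; split=> //; split=> // m /sN/nmin.
  - split=> [m /=|m i]; rewrite !inE.
      by move=> /andP[mn /sN Nm]; exact: NS.
    move=> /andP[mn sm] [l /= kl <-] im; apply/andP; split.
      by rewrite gtn_eqF//; exact: (increasing_ltn nlt).
    by apply: sinit im => //; exists l => //=; exact: ltnW.
have [_ _ _ Bbar] := hB.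
have [|s Bs sseg] := Bbar (N 0) (Ninf 0).
  by move=> _ [j _ <-]; exact: (xle 0 j (leq0n j) _ (xn j)).
exact: (noseg _ s 0 (leqnn _) Bs sseg).
Qed.

End BarrierInduction.

(** * Homogeneous sets, the ideal and the singletons of a barrier *)

Lemma FIN_set0 (M : set nat) (B : set {fset nat}) : barrier M B -> FIN M B set0.
Proof.
move: M B; apply: barrier_induction => [M _|M B hB Bn0 IH].
  exact: FIN_trivial.
apply: (@FIN_rec _ _ _ set0) => // n Mn _.
rewrite set0I (_ : strip n set0 = set0); first exact: IH.
by apply/seteqP; split=> [_ [s []]|].
Qed.

(* Nash-Williams' theorem: the diagonal set [n 0 < n 1 < ...] is chosen so that each
   section at [n k] is already homogeneous, and its colour is then stabilized. *)
Lemma barrier_homogeneous (M : set nat) (B : set {fset nat}) : barrier M B ->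
  forall S N, infinite_set N -> N `<=` M ->
  exists R, [/\ infinite_set R, R `<=` N & exists i, below B R `<=` side B S i].
Proof.
move: M B; apply: barrier_induction => [M _ S N Ninf NM|M B hB Bn0 IH S N Ninf NM].
  exists N; split=> //; exists (~~ `[< S fset0 >]).
  by move=> s [/= -> _]; case: asboolP.
pose sec n X := strip n (X `&` starting_at B n).
(* [h N'] packs a point [n] of [N'], an infinite part of [N'] above [n] that is homogeneous for the
   section at [n], and its colour. The value is a dummy when [N'] is not an infinite subset of
   [M]. *)
have /choice[h hP] : forall N' : set nat, exists y : nat * set nat * bool,
    infinite_set N' -> N' `<=` M -> [/\ N' y.1.1, infinite_set y.1.2,
      y.1.2 `<=` N' `&` [set m | (y.1.1 < m)%N] &
      below (strip y.1.1 (starting_at B y.1.1)) y.1.2 `<=`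
      side (strip y.1.1 (starting_at B y.1.1)) (sec y.1.1 S) y.2].
  move=> N'; have [N'inf|] := pselect (infinite_set N'); last first.
    by exists (0, set0, true).
  have [N'M|] := pselect (N' `<=` M); last by exists (0, set0, true).
  have [n N'n _] := infinite_unbounded 0 N'inf.
  have [||R [Rinf RN [i iP]]] := IH n (N'M _ N'n) (sec n S) (N' `&` [set m | (n < m)%N]).
  - exact: infinite_tail.
  - exact: setSI.
  - by exists (n, R, i).
pose Ns k := iter k (fun N' => (h N').1.2) N.
have NsP k : infinite_set (Ns k) /\ Ns k `<=` M.
  elim: k => [//|k [kinf kM]]; have [_ ? sub _] := hP _ kinf kM.
  by split=> // m /sub[/kM].
pose n k := (h (Ns k)).1.1; pose c k := (h (Ns k)).2.
have hk k := hP _ (NsP k).1 (NsP k).2.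
have Nsn k : Ns k (n k) by have [] := hk k.
have NsS k : Ns k.+1 `<=` Ns k `&` [set m | (n k < m)%N] by have [] := hk k.
have NsLe i j : (i <= j)%N -> Ns j `<=` Ns i.
  move=> /subnK<-; elim: (j - i)%N => [//|d IHd].
  by rewrite addSn => m /NsS[/IHd].
have nlt k : (n k < n k.+1)%N by have /NsS[] := Nsn k.+1.
have [i iP] : exists i, forall k, exists2 j, (k <= j)%N & c j = i.
  apply: contrapT => /forallNP nc.
  have /existsNP[k kP] := nc true; have /existsNP[l lP] := nc false.
  have [cj|cj] := boolP (c (maxn k l)).
    by apply: kP; exists (maxn k l) => //; exact: leq_maxl.
  by apply: lP; exists (maxn k l); [exact: leq_maxr|exact/negbTE].
exists (n @` [set j | c j = i]); split.
- apply: unbounded_infinite => k; have [j kj cj] := iP k.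
  by exists (n j); [exists j|exact: leq_trans kj (increasing_ge nlt _)].
- by move=> _ [j _ <-]; exact: (NsLe 0 j (leq0n j) _ (Nsn j)).
exists i => s [Bs sR].
have [|a sa aP] := starting_at_min Bs.
  by apply/eqP => s0; apply: Bn0; apply: barrier_fset0 hB _; rewrite -s0.
have [_ [_ amin]] := aP.
have [j /= cj ja] := sR _ sa.
(* The elements of [s] after its minimum [a = n j] are points [n l] with [l > j], so they lie in the
   set chosen homogeneous at stage [j]. *)
have aR : below (strip a (starting_at B a)) (Ns j.+1) (s `\ a)%fset.
  split; first by exists s.
  move=> m /=; rewrite !inE => /andP[ma sm].
  have am : (a < m)%N by rewrite ltn_neqAle eq_sym ma amin.
  have [l _ lm] := sR _ sm.
  rewrite -lm; apply: (NsLe j.+1 l) => //.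
  rewrite ltnNge; apply/negP; rewrite leq_eqVlt => /orP[/eqP lj|lj].
    by move: am; rewrite -lm lj ja ltnn.
  by have := increasing_ltn nlt lj; rewrite lm ja ltnNge ltnW.
have [_ _ _ /(_ (s `\ a)%fset)] := hk j.
rewrite -/(n j) -/(c j) ja cj => /(_ aR).
case: (i) => /= [[_ nS]|[t [St [_ [ta _]]] /(fsetD1_inj ta sa) <-]//].
by split=> // Ss; apply: nS; exists s.
Qed.

(** By induction on the derivation of [FIN]. Infinitely many sections may each bring their own
    bound, but one function suffices: an [s] with minimum [n] is tested only at points [a >= n], so
    at [a] only the finitely many sections with [n <= a] matter. *)
Lemma FIN_sparse_avoid (M : set nat) (B X : set {fset nat}) :
  FIN M B X -> barrier M B -> exists f k, forall s, X s ->
    sparse f [set` s] -> (forall a, a \in s -> (k <= a)%N) -> False.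
Proof.
elim=> {M B X} [M B X _ X0 _|M B X E Bn0 XB Efin _ IH hB].
  by exists id, 0 => s; rewrite X0.
have [_ BM _ _] := hB.
have /choice[h hP] : forall n, exists y : (nat -> nat) * nat, M n -> ~ E n ->
    forall s, strip n (X `&` starting_at B n) s -> sparse y.1 [set` s] ->
      (forall a, a \in s -> (y.2 <= a)%N) -> False.
  move=> n; have [Mn|] := pselect (M n); last by exists (id, 0).
  have [|nE] := pselect (E n); first by exists (id, 0).
  have [f [k fk]] := IH n Mn nE (barrier_strip hB Bn0 Mn).
  by exists (f, k).
have /finite_fsetP[E' EE'] := Efin.
(* The maximum also includes the threshold [(h n).2], so that sparseness at [n] pushes the rest of
   [s] beyond it. The lower bound on [s] in the next line keeps its minimum out of [E]. *)
exists (fun a => \max_(n < a.+1) maxn ((h n).1 a) (h n).2).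
exists (\max_(n <- E') n).+1 => s Xs ssp sk.
have Bs := XB _ Xs.
have [|n sn nP] := starting_at_min Bs.
  by apply/eqP => s0; apply: Bn0; apply: (barrier_fset0 hB); rewrite -s0.
have nE : ~ E n.
  rewrite EE' /= => nE'; have := sk _ sn.
  by rewrite (big_fsetD1 n)//= ltnNge leq_maxl.
have hle a b : a \in s -> b \in s -> (a < b)%N ->
    (maxn ((h n).1 a) (h n).2 < b)%N.
  move=> sa sb ab; apply: leq_ltn_trans (ssp _ _ sa sb ab).
  have na : (n < a.+1)%N by rewrite ltnS; case: nP => _ [_]; exact.
  exact: (@leq_bigmax _ (fun n : 'I_a.+1 => maxn ((h n).1 a) (h n).2) (Ordinal na)).
apply: (hP n (BM _ Bs _ sn) nE (s `\ n)%fset).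
- by exists s.
- move=> a b /=; rewrite !inE => /andP[_ sa] /andP[_ sb] /(hle _ _ sa sb).
  by apply: leq_ltn_trans; exact: leq_maxl.
- move=> b; rewrite !inE => /andP[bn sb].
  have nb : (n < b)%N by rewrite ltn_neqAle eq_sym bn; case: nP => _ [_]; exact.
  by have /ltnW := hle _ _ sn sb nb; apply: leq_trans; exact: leq_maxr.
Qed.

(** Otherwise, for every [m] there is a singleton [{a}] in [B] with [a > m]. The member of [B]
    starting the set of [m] and all [x >= a] cannot contain [a], as [B] is an antichain, so it is
    [{m}]. Thus [B] has all singletons and, again as an antichain, nothing else. *)
Lemma nontrivial_no_singletons (B : set {fset nat}) : barrier setT B ->
  nontrivial B -> exists k, forall a, (k <= a)%N -> ~ B [fset a]%fset.
Proof.
move=> hB [nB1 nB0]; have [_ _ Banti Bbar] := hB.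
have Bnil : ~ B fset0 by move=> /(barrier_fset0 hB).
apply: contrapT => /forallNP noK.
have B1 m : B [fset m]%fset.
  have /existsNP[a /not_implyP[ma /contrapT Ba]] := noK m.+1.
  have [||s Bs [sN sinit]] := Bbar (m |` [set x | (a <= x)%N]) => //.
    apply: unbounded_infinite => k; exists (maxn a k); last exact: leq_maxr.
    by right; exact: leq_maxl.
  have sa : a \notin s.
    apply/negP => sa; have sE : [fset a]%fset = s.
      by apply: Banti => //; rewrite fsub1set.
    have : m \in s by apply: (sinit a) => //; [left|exact: ltnW].
    by rewrite -sE inE => /eqP ma'; rewrite ma' ltnn in ma.
  have sm x : x \in s -> x = m.
    move=> sx; have [//|/= ax] := sN _ sx.
    by case/negP: sa; apply: (sinit x) => //; right => /=.
  suff -> : [fset m]%fset = s by [].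
  apply/fsetP => x; rewrite inE; apply/eqP/idP => [->|/sm//].
  have /fset0Pn[y sy] : s != fset0 by apply/eqP => s0; apply: Bnil; rewrite -s0.
  by rewrite -(sm _ sy).
apply: nB1; apply/seteqP; split=> s /=; last by move/eqP/cardfs1P => [m ->].
move=> Bs; have /fset0Pn[y sy] : s != fset0.
  by apply/eqP => s0; apply: Bnil; rewrite -s0.
suff <- : [fset y]%fset = s by rewrite cardfs1.
by apply: Banti => //; rewrite fsub1set.
Qed.

(** * Dominating, homogeneous and reaping families, and the inequalities between them *)

Definition dominating (D : set (nat -> nat)) : Prop :=
  forall f : nat -> nat, exists2 g, D g & \forall n \near \oo, (f n <= g n)%N.

Definition homogeneous_family (B : set {fset nat}) (H : set (set nat)) : Prop :=
  (forall M, H M -> infinite_set M) /\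
  forall S, S `<=` B -> exists2 M, H M & exists i, below B M `<=` side B S i.

Definition reaping_family (B : set {fset nat}) (R : set (set nat)) : Prop :=
  (forall M, R M -> infinite_set M) /\
  forall S, S `<=` B -> exists2 M, R M &
    exists i, subset_mod (FIN setT B) (below B M) (side B S i).

Lemma nearooP (P : nat -> Prop) :
  (\forall n \near \oo, P n) <-> exists k, forall n, (k <= n)%N -> P n.
Proof. by split=> [[k _ kP]|[k kP]]; exists k. Qed.

(** Diagonalization: one plus the maximum of the first [n] functions at [n] escapes any countable
    list. Infinitude is what lets Hessenberg's theorem apply to the maximum of the two cardinals. *)
Lemma dominating_infinite (D : set (nat -> nat)) : dominating D -> infinite_set D.
Proof.
move=> domD Dfin.
have [g0 Dg0 _] := domD id.
have /pfcard_geP[D0|/surjfunPex[e De]] := finite_set_countable Dfin.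
  by rewrite D0 in Dg0.
have [g + /nearooP[k gk]] := domD (fun n => (monotone_majorant (e^~ n) n).+1).
rewrite De => -[j _ ej]; have /= := gk (maxn k j) (leq_maxl _ _).
by rewrite -ej ltnNge (monotone_majorant_ge (e^~ _))// leq_maxr.
Qed.

Lemma homogeneous_exists (B : set {fset nat}) : barrier setT B ->
  homogeneous_family B [set M | infinite_set M].
Proof.
move=> hB; split=> // S _.
have [R [Rinf _ Rhom]] := barrier_homogeneous hB S infinite_nat (subsetT _).
by exists R.
Qed.

Lemma homogeneous_reaping (B : set {fset nat}) H : barrier setT B ->
  homogeneous_family B H -> reaping_family B H.
Proof.
move=> hB [Hinf Hhom]; split=> // S SB.
have [M HM [i Mi]] := Hhom S SB; exists M => //; exists i.
rewrite /subset_mod (_ : _ `\` _ = set0); first exact: FIN_set0.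
by rewrite setD_eq0.
Qed.

Lemma homogeneous_dominating (B : set {fset nat}) H : barrier setT B ->
  nontrivial B -> homogeneous_family B H ->
  exists2 D, dominating D & D #<= H.
Proof.
move=> hB ntB [Hinf Hhom]; have [_ _ _ Bbar] := hB.
have Bnil : ~ B fset0 by move=> /(barrier_fset0 hB); case: ntB.
have [k0 k0P] := nontrivial_no_singletons hB ntB.
(* [g n] is an element of [M] that has another element [a] of [M] between [n] and itself. *)
have /choice[g gP] : forall M : set nat, exists g : nat -> nat, infinite_set M ->
    forall n, exists2 a, M a & [/\ (n <= a)%N, (a < g n)%N & M (g n)].
  move=> M; have [Minf|] := pselect (infinite_set M); last by exists id.
  have /choice[g gP] : forall n, exists b, exists2 a, M a &
      [/\ (n <= a)%N, (a < b)%N & M b].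
    move=> n; have [a Ma na] := infinite_unbounded n Minf.
    by have [b Mb ab] := infinite_unbounded a.+1 Minf; exists b, a.
  by exists g.
exists (g @` H); last exact: card_image_le.
move=> f; pose F := monotone_majorant f.
pose S := [set s | B s /\ exists a b, [/\ a \in s, b \in s, (a < b)%N & (b <= F a)%N]].
have [|M HM [i Mi]] := Hhom S; first by move=> s [].
have Minf := Hinf _ HM; exists (g M); first by exists M.
(* The colour [S] is impossible: a subset of [M] sparse for [F] contains a member of [B], and that
   member is not in [S]. *)
have iT : i = true.
  apply: contrapT => /negP/negbTE i0; rewrite i0 /= in Mi.
  have [N [Ninf NM Nsp _]] := sparse_subset F 0 Minf.
  have [//|s Bs [sN _]] := Bbar N Ninf.
  have [|_ [a [b [sa sb ab]]]] := Mi s; first by split=> // x /sN/NM.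
  by rewrite leqNgt Nsp//; exact: sN.
apply/nearooP; exists k0 => n k0n; have [a Ma [na ab Mb]] := gP M Minf n.
set b := g M n in ab Mb *.
(* In this set [b] comes right after [a]. The member [s] starting it contains [a] and, as [a] is too
   large for [{a}] to be in [B], also [b]. Since [s] is not in [S], [f n <= F a < b]. *)
have [||s Bs [sN sinit]] := Bbar (a |` (M `&` [set x | (b <= x)%N])) => //.
  apply: unbounded_infinite => k.
  have [m Mm] := infinite_unbounded (maxn b k) Minf.
  by rewrite geq_max => /andP[bm km]; exists m => //; right.
have amin x : x \in s -> (a <= x)%N.
  by move=> /sN[->//|[_ /=]]; apply: leq_trans; exact: ltnW.
have sa : a \in s.
  have /fset0Pn[x sx] : s != fset0 by apply/eqP => s0; apply: Bnil; rewrite -s0.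
  by apply: (sinit x) => //; [left|exact: amin].
have sb : b \in s.
  have [x sx xa] : exists2 x, x \in s & x != a.
    apply: contrapT => nx; apply: (k0P a); first exact: leq_trans na.
    suff -> : [fset a]%fset = s by [].
    apply/fsetP => x; rewrite inE; apply/eqP/idP => [->//|sx].
    by apply: contrapT => /eqP xa; apply: nx; exists x.
  have [/eqP|[_ /= bx]] := sN _ sx; first by rewrite (negbTE xa).
  by apply: (sinit x) => //; right; split=> /=.
rewrite iT in Mi; have [|_ nS] := Mi s.
  by split=> // x /sN[->//|[]].
rewrite leqNgt; apply/negP => bf; apply: nS; split=> //.
exists a, b; split=> //; apply: leq_trans (ltnW bf) _.
exact: monotone_majorant_ge.
Qed.

Lemma card_le_setX (T T' U : Type) (A : set T) (A' : set T') (K : set U) :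
  infinite_set K -> A #<= K -> A' #<= K -> A `*` A' #<= K.
Proof.
move=> Kinf AK A'K; apply: card_le_trans (infinite_card_square Kinf).
have [u _] := infinite_setN0 Kinf.
have [f [fK finj]] := card_le_injP (inhabits u) AK.
have [f' [f'K f'inj]] := card_le_injP (inhabits u) A'K.
apply: (@card_le_inj _ _ _ _ (fun p => (f p.1, f' p.2))).
  by move=> [x y] [/= /fK ? /f'K].
move=> [x y] [x' y'] [/= Ax Ay] [/= Ax' Ay'] [fx fy].
by rewrite (finj x x')// (f'inj y y').
Qed.

(* [M] can be taken as a subset of [N] that is sparse for some [g] dominating
   the bound of [FIN_sparse_avoid]. *)
Lemma reaping_homogeneous (U : Type) (B : set {fset nat}) D R (K : set U) :
  barrier setT B -> dominating D -> reaping_family B R ->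
  infinite_set K -> D #<= K -> R #<= K ->
  exists2 H, homogeneous_family B H & H #<= K.
Proof.
move=> hB domD [Rinf Rreap] Kinf DK RK.
have /choice[m mP] : forall p : (nat -> nat) * set nat * nat, exists M : set nat,
    infinite_set p.1.2 -> [/\ infinite_set M, M `<=` p.1.2, sparse p.1.1 M &
    forall a, M a -> (p.2 <= a)%N].
  move=> [[g N] k] /=; have [Ninf|] := pselect (infinite_set N).
    by have [M MP] := sparse_subset g k Ninf; exists M.
  by exists set0.
(* The third index is a natural number, the point from which the thinned set starts; [K], being
   infinite, absorbs this countable factor. *)
exists (m @` (D `*` R `*` setT)); last first.
  apply: card_le_trans (card_image_le _ _) _.
  by do 2?apply: card_le_setX => //; apply/infiniteP.
split=> [_ [[[g N] k] [[/= _ RN] _] <-]|S SB].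
  by have [] := mP (g, N, k) (Rinf _ RN).
have [N RN [i FX]] := Rreap S SB.
have [f [k fk]] := FIN_sparse_avoid FX hB.
have [g Dg /nearooP[l gl]] := domD f.
(* Starting beyond [l] makes sparseness for [g] imply sparseness for [f]; starting beyond [k] meets
   the threshold of [FIN_sparse_avoid]. *)
have [_ MN Msp Mge] := mP (g, N, maxn k l) (Rinf _ RN).
exists (m (g, N, maxn k l)); first by exists (g, N, maxn k l).
exists i => s [Bs sM]; apply: contrapT => nsi.
apply: (fk s).
- by split=> //; split=> // x /sM/MN.
- move=> a b sa sb ab; apply: leq_ltn_trans (Msp _ _ (sM _ sa) (sM _ sb) ab).
  by apply: gl; apply: leq_trans (Mge _ (sM _ sa)); exact: leq_maxr.
- move=> a sa; apply: leq_trans (Mge _ (sM _ sa)); exact: leq_maxl.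
Qed.

Unset Implicit Arguments.

Theorem theorem6p13 (B : set {fset nat}) (hB : barrier setT B)
  (hB_nontrivial : nontrivial B) :
  hom_number B #= card_max dominating_number (reaping_number B).
Proof.
have Hex := homogeneous_exists hB.
have [Hhom Hmin] : homogeneous_family B (hom_number B) /\
    forall H, homogeneous_family B H -> hom_number B #<= H.
  by apply: card_minP; exists [set M | infinite_set M].
have [Rreap Rmin] : reaping_family B (reaping_number B) /\
    forall R, reaping_family B R -> reaping_number B #<= R.
  apply: card_minP; exists [set M | infinite_set M].
  exact: homogeneous_reaping.
have [Ddom Dmin] : dominating dominating_number /\
    forall D, dominating D -> dominating_number #<= D.
  apply: card_minP; exists setT => f; exists f => //.
  by apply/nearooP; exists 0.
rewrite card_eq_le; apply/andP; split.
  have /card_maxP[DK RK] := card_lexx (card_max dominating_number (reaping_number B)).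
  (* The maximum is infinite because it dominates the infinite cardinal [dominating_number]. *)
  have Kinf : infinite_set (card_max dominating_number (reaping_number B)).
    apply/infiniteP; apply: card_le_trans DK.
    exact/infiniteP/dominating_infinite.
  have [H Hh HK] := reaping_homogeneous hB Ddom Rreap Kinf DK RK.
  exact: card_le_trans (Hmin _ Hh) HK.
apply/card_maxP; split.
  have [D Dd DH] := homogeneous_dominating hB hB_nontrivial Hhom.
  exact: card_le_trans (Dmin _ Dd) DH.
by apply: Rmin; exact: homogeneous_reaping.
Qed.
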